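(* Let $k\geq 1$ be an integer. Then all positive integer solutions $(x,y)$ of the equation $x^{2}-(k^{2}+1)y^{2}=1$ are given by $$(x,y)=\left(\frac{V_{2n}(2k,1)}{2},U_{2n}(2k,1)\right)$$ with $n\geq 1$. That is, the set of pairs of positive integers solving the equation is exactly the set of these pairs as $n$ ranges over the integers $n\ge 1$.
   Context: For nonzero integers $m,s$ with $m^{2}+4s>0$, the generalized Fibonacci sequence is defined by $U_{0}(m,s)=0$, $U_{1}(m,s)=1$, $U_{n+1}(m,s)=mU_{n}(m,s)+sU_{n-1}(m,s)$ for $n\ge 1$, and the generalized Lucas sequence by $V_{0}(m,s)=2$, $V_{1}(m,s)=m$, $V_{n+1}(m,s)=mV_{n}(m,s)+sV_{n-1}(m,s)$ for $n\ge 1$. *)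

(* Defs.v *)
From mathcomp Require Import all_boot all_order all_algebra.

Set Implicit Arguments.
Unset Strict Implicit.
Unset Printing Implicit Defensive.

Import Order.TTheory GRing.Theory Num.Theory.
Local Open Scope ring_scope.

(* The sequences are usually considered only for m, s nonzero with
   m ^+ 2 + 4 * s > 0; the recurrences make sense for all integers m, s, so
   no such hypothesis is carried by the definitions. *)
Fixpoint gen_fib (m s : int) (n : nat) : int :=
  match n with
  | 0%N => 0
  | 1%N => 1
  | (n''.+1 as n').+1 => m * gen_fib m s n' + s * gen_fib m s n''
  end.

Fixpoint gen_lucas (m s : int) (n : nat) : int :=
  match n with
  | 0%N => 2
  | 1%N => m
  | (n''.+1 as n').+1 => m * gen_lucas m s n' + s * gen_lucas m s n''
  end.

(* Main.v *)
Require Import Defs.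
From mathcomp Require Import all_boot all_order all_algebra.
From mathcomp Require Import zify ring.

(** Put d = k^2 + 1.  The element e = k + sqrt d of Z[sqrt d] has norm -1 and
    is a root of X^2 - 2k X - 1, so its powers are
    e^n = pell_x k n + U_n sqrt d with U_n = U_n(2k, 1) and
    pell_x k n = V_n(2k, 1) / 2 ([gen_lucas_pell_x]).  Taking norms,
    (pell_x k n)^2 - d U_n^2 = (-1)^n ([pell_norm]), so the even powers solve
    the equation.

    Conversely, every x + y sqrt d of norm 1 or -1 with x > 0 and y >= 0 is a
    power of e ([pell_descent]).  Indeed, as long as y > 0, dividing by e
    gives (d y - k x) + (x - k y) sqrt d, which still has norm 1 or -1, a
    positive first coordinate and a nonnegative but strictly smaller second
    one; the descent stops at y = 0, that is, at 1 = e^0.  Admitting both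
    norms makes a division by e, rather than by e^2, available; the norm of
    e^n then forces n to be even when the norm is 1. *)

Set Implicit Arguments.
Unset Strict Implicit.
Unset Printing Implicit Defensive.

Import Order.TTheory GRing.Theory Num.Theory.
Local Open Scope ring_scope.

(** The rational part of (k + sqrt (k^2 + 1))^n, expressed through the
    irrational parts of two consecutive powers: e^(n+1) = k e^n + sqrt d e^n
    has irrational part k U_n + pell_x k n. *)
Definition pell_x (k : int) (n : nat) : int :=
  gen_fib (2 * k) 1 n.+1 - k * gen_fib (2 * k) 1 n.

Lemma gen_fibSS (m s : int) (n : nat) :
  gen_fib m s n.+2 = m * gen_fib m s n.+1 + s * gen_fib m s n.
Proof. by []. Qed.

Lemma gen_lucasSS (m s : int) (n : nat) :
  gen_lucas m s n.+2 = m * gen_lucas m s n.+1 + s * gen_lucas m s n.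
Proof. by []. Qed.

Lemma gen_fib_pellS (k : int) (n : nat) :
  gen_fib (2 * k) 1 n.+1 = pell_x k n + k * gen_fib (2 * k) 1 n.
Proof. by rewrite subrK. Qed.

Lemma pell_xS (k : int) (n : nat) :
  pell_x k n.+1 = k * pell_x k n + (k ^+ 2 + 1) * gen_fib (2 * k) 1 n.
Proof. by rewrite /pell_x gen_fibSS; ring. Qed.

Lemma gen_lucas_pell_x (k : int) (n : nat) :
  gen_lucas (2 * k) 1 n = 2 * pell_x k n.
Proof.
suff [] : gen_lucas (2 * k) 1 n = 2 * pell_x k n /\
          gen_lucas (2 * k) 1 n.+1 = 2 * pell_x k n.+1 by [].
elim: n => [|n [IH0 IH1]]; first by split; rewrite /pell_x /=; ring.
by split=> //; rewrite gen_lucasSS IH0 IH1 /pell_x !gen_fibSS; ring.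
Qed.

Lemma pell_norm (k : int) (n : nat) :
  pell_x k n ^+ 2 - (k ^+ 2 + 1) * gen_fib (2 * k) 1 n ^+ 2 = (- 1) ^+ n.
Proof.
elim: n => [|n IH]; first by rewrite /pell_x /=; ring.
by rewrite [in RHS]exprS -IH pell_xS gen_fib_pellS; ring.
Qed.

Lemma pell_ge0 (k : int) (n : nat) :
  1 <= k -> 0 < pell_x k n /\ 0 <= gen_fib (2 * k) 1 n.
Proof.
move=> hk; elim: n => [|n [IHx IHy]]; first by rewrite /pell_x /= mulr0.
by rewrite pell_xS gen_fib_pellS; split; nia.
Qed.

Lemma gen_fib_gt0 (k : int) (n : nat) :
  1 <= k -> (0 < n)%N -> 0 < gen_fib (2 * k) 1 n.
Proof.
case: n => // n hk _; have [x_gt0 y_ge0] := pell_ge0 n hk.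
by rewrite gen_fib_pellS; nia.
Qed.

(** Here d = k^2 + 1.  Each inequality compares two nonnegative numbers
    through their squares; substituting x^2 = d y^2 + c leaves the differences
    k^2 (y^2 - c) + y^2, y^2 + c and 2 k y^2 - c, whose signs are clear since
    y^2 >= 1 >= |c|. *)
Lemma pell_descent_step (k x y c : int) :
    1 <= k -> 0 < x -> 0 < y -> c = 1 \/ c = - 1 ->
    x ^+ 2 - (k ^+ 2 + 1) * y ^+ 2 = c ->
  [/\ 0 < (k ^+ 2 + 1) * y - k * x, 0 <= x - k * y & x - k * y < y].
Proof.
move=> hk x_gt0 y_gt0 hc norm_xy.
have y2_ge1 : 1 <= y ^+ 2 by nia.
have x2E : x ^+ 2 = (k ^+ 2 + 1) * y ^+ 2 + c by rewrite -norm_xy; ring.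
have k_ge0 : 0 <= k by lia.
split.
- rewrite subr_gt0 -(ltr_pXn2r (n := 2)) ?nnegrE //; [|nia|nia].
  rewrite -subr_gt0 !exprMn x2E.
  have -> : (k ^+ 2 + 1) ^+ 2 * y ^+ 2 - k ^+ 2 * ((k ^+ 2 + 1) * y ^+ 2 + c)
            = k ^+ 2 * (y ^+ 2 - c) + y ^+ 2 by ring.
  have : 0 <= k ^+ 2 * (y ^+ 2 - c) by apply: mulr_ge0; [exact: sqr_ge0|lia].
  lia.
- rewrite subr_ge0 -(ler_pXn2r (n := 2)) ?nnegrE //; [|nia|nia].
  by rewrite exprMn x2E mulrDl mul1r; lia.
- rewrite ltrBlDr -(ltr_pXn2r (n := 2)) ?nnegrE //; [|nia|nia].
  rewrite x2E -subr_gt0.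
  have -> : (y + k * y) ^+ 2 - ((k ^+ 2 + 1) * y ^+ 2 + c)
            = 2 * (k * y ^+ 2) - c by ring.
  have : 1 <= k * y ^+ 2 by nia.
  lia.
Qed.

Lemma pell_descent (k x y c : int) :
    1 <= k -> 0 < x -> 0 <= y -> c = 1 \/ c = - 1 ->
    x ^+ 2 - (k ^+ 2 + 1) * y ^+ 2 = c ->
  exists n : nat, x = pell_x k n /\ y = gen_fib (2 * k) 1 n.
Proof.
move=> hk; have [N] := ubnP `|y|%N.
elim: N x y c => // N IH x y c leyN x_gt0 y_ge0 hc norm_xy.
have [y0|y_neq0] := eqVneq y 0.
  exists 0%N; split=> //; rewrite /pell_x /= mulr0 subr0.
  by move: norm_xy; rewrite y0 expr0n mulr0 subr0; nia.
have y_gt0 : 0 < y by lia.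
have [x'_gt0 y'_ge0 lt_y'y] := pell_descent_step hk x_gt0 y_gt0 hc norm_xy.
have hc' : - c = 1 \/ - c = - 1 by case: hc => ->; [right|left].
have norm' : ((k ^+ 2 + 1) * y - k * x) ^+ 2
             - (k ^+ 2 + 1) * (x - k * y) ^+ 2 = - c.
  by rewrite -norm_xy; ring.
have lt_N : (`|(x - k * y)%R| < N)%N by lia.
have [n [x'E y'E]] := IH _ _ _ lt_N x'_gt0 y'_ge0 hc' norm'.
by exists n.+1; rewrite pell_xS gen_fib_pellS -x'E -y'E; split; ring.
Qed.

Lemma half_gen_lucas (k x : int) (n : nat) :
  x%:~R = (gen_lucas (2 * k) 1 n)%:~R / 2 :> rat <-> x = pell_x k n.
Proof.
rewrite gen_lucas_pell_x intrM mulrC mulKf //.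
by split=> [/intr_inj|->].
Qed.

Theorem theorem15 (k : int) (hk : 1 <= k) (x y : int) :
  [/\ 0 < x, 0 < y & x ^+ 2 - (k ^+ 2 + 1) * y ^+ 2 = 1] <->
  exists n : nat,
    [/\ (1 <= n)%N,
        x%:~R = (gen_lucas (2 * k) 1 (2 * n))%:~R / 2 :> rat
      & y = gen_fib (2 * k) 1 (2 * n)].
Proof.
split=> [[x_gt0 y_gt0 norm_xy]|[n [n_gt0 /half_gen_lucas -> ->]]]; last first.
  split; [by have [] := pell_ge0 (2 * n) hk | |].
  - by apply: gen_fib_gt0; rewrite ?muln_gt0.
  - by rewrite pell_norm exprM sqrrN !expr1n.
have [j [xE yE]] :=
  pell_descent hk x_gt0 (ltW y_gt0) (or_introl erefl) norm_xy.
have even_j : ~~ odd j.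
  apply/negP=> odd_j; move: norm_xy.
  by rewrite xE yE pell_norm -signr_odd odd_j.
have jE : j = (2 * j./2)%N by rewrite mul2n even_halfK.
exists j./2; split; last by rewrite -jE.
- by case: (j) jE yE y_gt0 => [_ -> //|i]; lia.
- by apply/half_gen_lucas; rewrite -jE.
Qed.
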